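(* Let $\mathcal H$ be a complex Hilbert space and let $(T_1,T_2)$ be a pair of commuting bounded linear operators on $\mathcal H$ with $\|T_1\|<1$ and $\|T_2\|<1$. Then $(T_1,T_2)$ admits a minimal isometric dilation on the Hilbert space $\mathcal H\oplus_2 \ell_2(\mathcal H\oplus_2\mathcal H)$. That is, there exist commuting isometries $V_1,V_2$ on $\mathcal K=\mathcal H\oplus_2 \ell_2(\mathcal H\oplus_2\mathcal H)$ (where $\mathcal H$ is identified with the subspace $\{(h,\mathbf 0,\mathbf 0,\dots)\}$) such that $P_{\mathcal H}V_1^{s_1}V_2^{s_2}h=T_1^{s_1}T_2^{s_2}h$ for all $h\in\mathcal H$ and all $s_1,s_2\in\mathbb N\cup\{0\}$, and $\mathcal K=\overline{\operatorname{span}}\{V_1^{s_1}V_2^{s_2}h: h\in\mathcal H,\ s_1,s_2\in\mathbb N\cup\{0\}\}$.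
   Context: For normed spaces $\mathbb X_1,\mathbb X_2$, the direct $2$-sum $\mathbb X_1\oplus_2\mathbb X_2$ is the space of pairs $(x_1,x_2)$ with norm $\|(x_1,x_2)\|=(\|x_1\|^2+\|x_2\|^2)^{1/2}$. For a normed space $\mathbb X$, $\ell_2(\mathbb X)$ is the space of sequences $(x_n)_{n\ge1}$ in $\mathbb X$ with $\sum\|x_n\|^2<\infty$, normed by $(\sum_n\|x_n\|^2)^{1/2}$. $P_{\mathcal H}$ denotes the orthogonal projection of $\mathcal K$ onto $\mathcal H$. All spaces are over $\mathbb C$ and all operators are bounded and linear. *)

(* Defs.v *)
(* Complex scalars: R[i] = complex R, R : realType. *)
From mathcomp Require Import all_boot all_order all_algebra.
From mathcomp Require Import all_classical all_reals all_analysis.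
From mathcomp Require Export complex.
Export GRing.Theory Num.Theory.

Set Implicit Arguments.
Unset Strict Implicit.
Unset Printing Implicit Defensive.

Local Open Scope ring_scope.
Local Open Scope complex_scope.
Local Open Scope classical_set_scope.

Section Hilbert.
Variables (R : realType) (H : lmodType R[i]) (ip : H -> H -> R[i]).

(* squared norm and norm induced by the inner product *)
Definition hnorm2 (x : H) : R := complex.Re (ip x x).
Definition hnorm (x : H) : R := Num.sqrt (hnorm2 x).

(* (H, ip) is a complex Hilbert space: ip is an inner product (linear in the
   first variable, conjugate symmetric, positive definite) and H is complete
   for the induced norm. *)
Definition is_hilbert_space : Prop :=
  [/\ (forall (a : R[i]) (x y z : H), ip (a *: x + y) z = a * ip x z + ip y z),
      (forall x y : H, ip x y = (ip y x)^*),
      (forall x : H, 0 <= ip x x),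
      (forall x : H, ip x x = 0 -> x = 0)
    & (forall u : nat -> H,
        (forall e : R, 0 < e -> exists N : nat, forall m n : nat,
            (N <= m)%N -> (N <= n)%N -> hnorm (u m - u n) < e) ->
        exists l : H, forall e : R, 0 < e -> exists N : nat, forall n : nat,
            (N <= n)%N -> hnorm (u n - l) < e)].

(* bounded operators and the operator norm *)
Definition bounded_op (T : H -> H) : Prop :=
  exists M : R, forall x : H, hnorm (T x) <= M * hnorm x.

Definition opnorm (T : H -> H) : R :=
  sup [set hnorm (T x) | x in [set x : H | hnorm x <= 1]].

(* The space K = H (+)_2 l_2(H (+)_2 H), realised inside the ambient
   C-vector space KT = H * (nat -> H * H) as the square-summable elements. *)
Definition KT : lmodType R[i] := (H * (nat -> H * H))%type.

Definition tail_norm2 (k : KT) (n : nat) : R := hnorm2 (k.2 n).1 + hnorm2 (k.2 n).2.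

Definition inK (k : KT) : Prop :=
  (\sum_(0 <= n <oo) (tail_norm2 k n)%:E < +oo)%E.

Definition knorm2 (k : KT) : R :=
  hnorm2 k.1 + fine (\sum_(0 <= n <oo) (tail_norm2 k n)%:E)%E.
Definition knorm (k : KT) : R := Num.sqrt (knorm2 k).

(* H identified with {(h, 0, 0, ...)} inside K, and the orthogonal projection
   P_H of K onto it *)
Definition embedH (h : H) : KT := (h, fun _ => (0, 0)).
Definition PH (k : KT) : KT := (k.1, fun _ => (0, 0)).

(* bounded linear operators on K which are isometries *)
Definition K_isometry (V : KT -> KT) : Prop :=
  [/\ (forall k, inK k -> inK (V k)),
      (forall (a : R[i]) k l, inK k -> inK l -> V (a *: k + l) = a *: V k + V l)
    & (forall k, inK k -> knorm (V k) = knorm k)].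

Definition K_commute (V1 V2 : KT -> KT) : Prop :=
  forall k, inK k -> V1 (V2 k) = V2 (V1 k).

(* V1^s1 V2^s2 *)
Definition mon2 (V1 V2 : KT -> KT) (s1 s2 : nat) (k : KT) : KT :=
  iter s1 V1 (iter s2 V2 k).
Definition mon2H (T1 T2 : H -> H) (s1 s2 : nat) (h : H) : H :=
  iter s1 T1 (iter s2 T2 h).

(* (V1, V2) is an isometric dilation of (T1, T2) on K *)
Definition is_dilation (T1 T2 : H -> H) (V1 V2 : KT -> KT) : Prop :=
  forall (h : H) (s1 s2 : nat),
    PH (mon2 V1 V2 s1 s2 (embedH h)) = embedH (mon2H T1 T2 s1 s2 h).

(* minimality: K is the closed linear span of {V1^s1 V2^s2 h} *)
Definition is_minimal (V1 V2 : KT -> KT) : Prop :=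
  forall k : KT, inK k -> forall e : R, 0 < e ->
    exists (n : nat) (a : 'I_n -> R[i]) (h : 'I_n -> H) (s1 s2 : 'I_n -> nat),
      knorm (k - \sum_(j < n) a j *: mon2 V1 V2 (s1 j) (s2 j) (embedH (h j))) < e.

End Hilbert.

(* Main.v *)
(** Andô's construction with one extra choice of unitary. Put T = T1 T2 and let
D1, D2 be invertible square roots of I - Ti^* Ti. Since T1 and T2 commute,
|D2 h|^2 + |D1 T2 h|^2 = |h|^2 - |T h|^2 = |D2 T1 h|^2 + |D1 h|^2, so
(D2 h, D1 T2 h) |-> (D2 T1 h, D1 h) is an isometry between two closed subspaces of
H (+) H. Both are graphs of bounded operators on H (because D2 and D1 are
invertible), hence both complements are isomorphic to H and the isometry extends
to a unitary U of H (+) H. Then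
  V1 (h, (x_n, y_n)_n) = (T1 h, (U (x_n, y_(n-1)))_n)         with y_(-1) = D1 h,
  V2 (h, (U (x_n, y_n))_n) = (T2 h, ((x_(n-1), y_n))_n)       with x_(-1) = D2 h
are commuting isometries, and V1 V2 shifts the l_2 part. Minimality holds whatever
the extension U: V2 h - T2 h gives all (a, 0) in the first slot, applying V1 gives
all U (a, 0), V1 h - T1 h gives all U (0, b), and V1 V2 moves to the next slots. *)
Require Import Defs.
From HB Require Import structures.
From mathcomp Require Import all_boot all_order all_algebra.
From mathcomp Require Import all_classical all_reals all_analysis.
From mathcomp Require Import complex.
From mathcomp Require Import ring lra.
Import Order.TTheory GRing.Theory Num.Theory.
Import numFieldNormedType.Exports.
Local Open Scope ring_scope.
Local Open Scope complex_scope.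

Set Implicit Arguments.
Unset Strict Implicit.
Unset Printing Implicit Defensive.

(** * Linear maps and real inequalities *)

(** Functions obtained pointwise, by choice or as limits, become bundled linear maps this way. *)
Lemma linear_pack (C : nzRingType) (U V : lmodType C) (f : U -> V) :
  linear f -> exists g : {linear U -> V}, g =1 f.
Proof.
move=> lf; pose g : {linear U -> V} := HB.pack f (GRing.isLinear.Build _ _ _ _ f lf).
by exists g.
Qed.

Lemma linear_inverse (C : nzRingType) (U V : lmodType C) (f : {linear U -> V}) :
  (forall x, f x = 0 -> x = 0) -> (forall y, exists x, f x = y) ->
  exists g : {linear V -> U}, cancel f g /\ cancel g f.
Proof.
move=> finj /choice[g gK].
have fi : injective f.
  by move=> x y fxy; apply/eqP; rewrite -subr_eq0; apply/eqP/finj; rewrite linearB fxy subrr.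
have [h hE] : exists h : {linear V -> U}, h =1 g.
  apply: linear_pack => a x y; apply: fi.
  by rewrite linearP !gK.
exists h; split => x; rewrite hE ?gK //.
by apply: fi; rewrite gK.
Qed.

(** The discriminant criterion, with no sign assumed on [c]. It yields Cauchy-Schwarz and the
    first-variation step of the Riesz theorem. *)
Lemma discr_bound (R : realFieldType) (a b c : R) :
  (forall t, 0 <= a + 2 * t * b + t ^+ 2 * c) -> b ^+ 2 <= a * c.
Proof.
move=> h.
have := h 0; rewrite mulr0 mul0r expr0n /= mul0r !addr0 => a0.
have [c0|c0|c0] := ltgtP c 0.
(* This case is absurd: [t >= 1] and [t * - c > a] make the sum of the values at [t] and [- t],
   namely [2 * a + 2 * t ^+ 2 * c], negative. *)
- have tc : (1 + (a + 1) / - c) * - c = - c + (a + 1) by field; lra.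
  have t1 : 0 <= (a + 1) / - c by apply: divr_ge0; lra.
  set t := 1 + (a + 1) / - c in tc.
  have := h t; have := h (- t); rewrite sqrrN expr2.
  have : 1 <= t by rewrite /t; lra.
  nra.
- have h1 := h (- b / c).
  have : 0 <= (a + 2 * (- b / c) * b + (- b / c) ^+ 2 * c) * c by apply: mulr_ge0; lra.
  have -> : (a + 2 * (- b / c) * b + (- b / c) ^+ 2 * c) * c = a * c - b ^+ 2.
    by field; lra.
  lra.
- subst c; rewrite mulr0.
  have [->|b0] := eqVneq b 0; first by rewrite expr0n.
  have := h (- (a + 1) / (2 * b)).
  have -> : a + 2 * (- (a + 1) / (2 * b)) * b + (- (a + 1) / (2 * b)) ^+ 2 * 0 = -1.
    by field.
  lra.
Qed.

(** Limits in [H] come with geometric error bounds; letting the error tend to 0 here replaces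
    topological limit arguments in [H]. *)
Lemma le0_of_geometric (R : archiRealFieldType) (r K z : R) : 0 <= r -> r < 1 ->
  (forall n, z <= K * r ^+ n) -> z <= 0.
Proof.
move=> r0 r1 h; have [//|z0] := leP z 0.
have : (geometric K r x @[x --> \oo] --> 0)%classic.
  by apply: cvg_geometric; rewrite ger0_norm.
move/cvgrPdist_lt => /(_ _ z0) [N _ /(_ N (leqnn N))] /=.
rewrite sub0r normrN.
have := h N; have := ler_norm (K * r ^+ N); lra.
Qed.

(** * The real part of the inner product *)

Section RealInnerProduct.
Variables (R : realType) (H : lmodType R[i]) (ip : H -> H -> R[i]).
Hypothesis hilbert : is_hilbert_space ip.

(** The real part alone determines the norm and makes [H] a real inner product space, so most
    estimates stay over the reals. Complex scalars enter through [ripJ]. *)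
Definition rip (x y : H) : R := complex.Re (ip x y).
Local Notation "''[' x , y ]" := (rip x y).
Local Notation N := (hnorm ip).

Lemma ripDl x y z : '[x + y, z] = '[x, z] + '[y, z].
Proof.
case: hilbert => lin _ _ _ _.
by rewrite /rip -(scale1r x) lin scale1r mul1r raddfD.
Qed.

Lemma ripC x y : '[x, y] = '[y, x].
Proof. by case: hilbert => _ cs _ _ _; rewrite /rip cs; case: (ip y x). Qed.

Lemma ripDr x y z : '[x, y + z] = '[x, y] + '[x, z].
Proof. by rewrite ripC ripDl !(ripC x). Qed.

Lemma rip0l x : '[0, x] = 0.
Proof. by have := ripDl 0 0 x; rewrite addr0; lra. Qed.

Lemma rip0r x : '[x, 0] = 0.
Proof. by rewrite ripC rip0l. Qed.

Lemma ripJ a x y : '[a *: x, y] = '[x, a^* *: y].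
Proof.
case: hilbert => lin cs _ _ _.
have ip0 z : ip 0 z = 0.
  by have /eqP := lin 1 0 0 z; rewrite scale1r mul1r addr0 addrC -subr_eq subrr => /eqP.
rewrite /rip (cs x) -[a *: x]addr0 -[_ *: y]addr0 !lin !ip0 !addr0 (cs y).
by case: a (ip x y) => [a1 a2] [b1 b2] /=; ring.
Qed.

Lemma ripZl (r : R) x y : '[r%:C *: x, y] = r * '[x, y].
Proof.
case: hilbert => lin _ _ _ _.
have ip0 z : ip 0 z = 0.
  by have /eqP := lin 1 0 0 z; rewrite scale1r mul1r addr0 addrC -subr_eq subrr => /eqP.
rewrite /rip -[_ *: x]addr0 lin ip0 addr0.
by case: (ip x y) => b1 b2 /=; ring.
Qed.

Lemma ripZr (r : R) x y : '[x, r%:C *: y] = r * '[x, y].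
Proof. by rewrite ripC ripZl ripC. Qed.

Lemma ripNl x y : '[- x, y] = - '[x, y].
Proof. by have := ripDl x (- x) y; rewrite subrr rip0l; lra. Qed.

Lemma ripNr x y : '[x, - y] = - '[x, y].
Proof. by rewrite ripC ripNl ripC. Qed.

Definition ripE := (ripDl, ripDr, ripNl, ripNr, ripZl, ripZr).

Lemma rip_ge0 x : 0 <= '[x, x].
Proof.
case: hilbert => _ _ pos _ _; have := pos x.
by rewrite /rip; case: (ip x x) => a b; rewrite lecE /= => /andP[].
Qed.

Lemma rip_eq0 x : '[x, x] = 0 -> x = 0.
Proof.
case: hilbert => _ cs _ def _ x0; apply: def.
by have := cs x x; move: x0; rewrite /rip; case: (ip x x) => a b /= -> [] bN; congr (_ +i* _); lra.
Qed.

Lemma hnorm_ge0 x : 0 <= N x. Proof. exact: sqrtr_ge0. Qed.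

Lemma hnorm_sqr x : N x ^+ 2 = '[x, x].
Proof. by rewrite sqr_sqrtr //; apply: rip_ge0. Qed.

Lemma hnorm_eq0 x : N x <= 0 -> x = 0.
Proof.
move=> x0; apply: rip_eq0; rewrite -hnorm_sqr.
by have -> : N x = 0; [have := hnorm_ge0 x; lra | rewrite expr0n].
Qed.

Lemma hnorm0 : N 0 = 0.
Proof. by rewrite /hnorm [hnorm2 _ _]rip0l sqrtr0. Qed.

Lemma hnormN x : N (- x) = N x.
Proof. by rewrite /hnorm; congr Num.sqrt; rewrite -[LHS]/(rip _ _) !ripE opprK. Qed.

Lemma hnormB x y : N (x - y) = N (y - x).
Proof. by rewrite -hnormN opprB. Qed.

Lemma hnorm_le x c : 0 <= c -> '[x, x] <= c ^+ 2 -> N x <= c.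
Proof.
move=> c0; rewrite -hnorm_sqr => h.
by rewrite -(ler_pXn2r (n := 2)) // nnegrE // hnorm_ge0.
Qed.

Lemma hnormZr (r : R) x : N (r%:C *: x) = `|r| * N x.
Proof.
apply/eqP; rewrite -(eqrXn2 (n := 2)) // ?mulr_ge0 ?hnorm_ge0 //.
by rewrite exprMn !hnorm_sqr !ripE -normrX ger0_norm ?sqr_ge0 // expr2 mulrA.
Qed.

(** The form of [X] is nonnegative at [x + t y] for all real [t], which bounds its discriminant.
    Taking [X] to be the identity gives the usual inequality. *)
Lemma psd_cauchy_schwarz (X : {linear H -> H}) (x y : H) :
  (forall x y, '[X x, y] = '[x, X y]) -> (forall x, 0 <= '[X x, x]) ->
  '[X x, y] ^+ 2 <= '[X x, x] * '[X y, y].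
Proof.
move=> sX pX; apply: discr_bound => t.
have := pX (x + t%:C *: y); rewrite linearD linearZ /= !ripE.
by rewrite (ripC (X y) x) -sX; lra.
Qed.

Lemma cauchy_schwarz x y : `|'[x, y]| <= N x * N y.
Proof.
rewrite -(ler_pXn2r (n := 2)) // ?nnegrE ?mulr_ge0 ?hnorm_ge0 //.
rewrite exprMn !hnorm_sqr -normrX ger0_norm ?sqr_ge0 //.
exact: (@psd_cauchy_schwarz idfun x y (fun _ _ => erefl) rip_ge0).
Qed.

Lemma hnormD x y : N (x + y) <= N x + N y.
Proof.
apply: hnorm_le; first by rewrite addr_ge0 ?hnorm_ge0.
rewrite !ripE (ripC y x) sqrrD -!hnorm_sqr.
by have := cauchy_schwarz x y; have := ler_norm '[x, y]; lra.
Qed.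

Lemma hnormZ_le (a : R[i]) : exists2 c, 0 <= c & forall x, N (a *: x) <= c * N x.
Proof.
exists (Num.sqrt (complex.Re a ^+ 2 + complex.Im a ^+ 2)) => [|x]; first exact: sqrtr_ge0.
apply: hnorm_le; first by rewrite mulr_ge0 ?sqrtr_ge0 ?hnorm_ge0.
rewrite exprMn sqr_sqrtr ?addr_ge0 ?sqr_ge0 // hnorm_sqr ripJ scalerA.
have -> : a^* * a = (complex.Re a ^+ 2 + complex.Im a ^+ 2)%:C.
  by case: a => a1 a2 /=; apply/eqP; rewrite eq_complex /=; apply/andP; split; apply/eqP; ring.
by rewrite ripZr.
Qed.

Lemma eq_from_rip x y : (forall z, '[z, x] = '[z, y]) -> x = y.
Proof.
move=> h; apply/eqP; rewrite -subr_eq0; apply/eqP/rip_eq0.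
by rewrite ripDr ripNr h subrr.
Qed.

(** * Completeness: limits with a rate, Riesz representation, adjoints *)

(** Telescoping bounds [u (n + k) - u n] by a geometric tail, so the sequence is Cauchy and the
    bound survives in the limit. *)
Lemma geometric_limit (u : nat -> H) (C r : R) : 0 <= C -> 0 <= r -> r < 1 ->
  (forall n, N (u n.+1 - u n) <= C * r ^+ n) ->
  exists l, forall n, N (u n - l) <= C / (1 - r) * r ^+ n.
Proof.
move=> C0 r0 r1 hu.
have D0 : 0 <= C / (1 - r) by apply: divr_ge0; lra.
have rn n : 0 <= r ^+ n by apply: exprn_ge0.
have tel n k : N (u (n + k)%N - u n) <= C / (1 - r) * (r ^+ n - r ^+ (n + k)).
  elim: k => [|k IH]; first by rewrite addn0 !subrr hnorm0 mulr0.
  have -> : u (n + k.+1)%N - u n = (u (n + k).+1 - u (n + k)%N) + (u (n + k)%N - u n).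
    by rewrite addnS addrA subrK.
  apply: le_trans (hnormD _ _) _.
  have := hu (n + k)%N; rewrite addnS exprS.
  have : C = C / (1 - r) * (1 - r) by field; lra.
  by move: (C / _) IH => D IH ->; lra.
have cau (e : R) : 0 < e -> exists M : nat, forall m n : nat,
    (M <= m)%N -> (M <= n)%N -> N (u m - u n) < e.
  move=> e0.
  have [M hM] : exists M, C / (1 - r) * r ^+ M < e / 2.
    apply: contrapT => /forallNP hM.
    suff : e / 2 <= 0 by lra.
    apply: (le0_of_geometric r0 r1 (K := C / (1 - r))) => n.
    by rewrite leNgt; apply/negP/hM.
  exists M => m n Mm Mn.
  have -> : u m - u n = (u m - u M) - (u n - u M) by rewrite opprB addrA subrK.
  apply: le_lt_trans (hnormD _ _) _; rewrite hnormN.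
  have := tel M (m - M)%N; have := tel M (n - M)%N; rewrite !subnKC //.
  by have := mulr_ge0 D0 (rn m); have := mulr_ge0 D0 (rn n); lra.
case: hilbert => _ _ _ _ /(_ u cau)[l hl].
(* If the bound failed at [n], a late term of [u] would be closer to [l] than the excess, against
   the telescoped estimate. *)
exists l => n; rewrite leNgt; apply/negP => hlt.
have [M /(_ (n + M)%N (leq_addl _ _))] := hl (N (u n - l) - C / (1 - r) * r ^+ n) ltac:(lra).
have -> : u n - l = (u (n + M)%N - l) - (u (n + M)%N - u n) by rewrite opprB [RHS]addrC addrA subrK.
have := hnormD (u (n + M)%N - l) (- (u (n + M)%N - u n)); rewrite hnormN.
have := tel n M; have := mulr_ge0 D0 (rn (n + M)%N); lra.
Qed.

(* The representing vector minimises J x = |x|^2 - 2 f x; a minimising sequence is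
   Cauchy by the parallelogram law. *)
Lemma riesz (f : H -> R) (M : R) : (forall x y, f (x + y) = f x + f y) ->
  (forall (r : R) x, f (r%:C *: x) = r * f x) -> (forall x, `|f x| <= M * N x) ->
  exists l, forall x, f x = '[x, l].
Proof.
move=> fD fZ fM.
have fN x : f (- x) = - f x by rewrite -scaleN1r -[in LHS](rmorphN1 (real_complex R)) fZ mulN1r.
pose J x := '[x, x] - 2 * f x.
have Jlow x : - M ^+ 2 <= J x.
  rewrite /J -hnorm_sqr.
  have := fM x; have := ler_norm (f x); have := sqr_ge0 (N x - M); rewrite sqrrB; lra.
pose m := inf (range J)%classic.
have hinf : has_inf (range J)%classic.
  split; first by exists (J 0), 0.
  by exists (- M ^+ 2) => _ [x _ <-].
have mJ x : m <= J x by apply: ge_inf; [case: hinf | exists x].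
have near (e : R) : 0 < e -> exists x, J x < m + e.
  by move=> e0; have [_ [x _ <-] h] := inf_adherent e0 hinf; exists x.
have /choice[u hu] n : exists x, J x < m + n.+1%:R^-1 by apply: near; rewrite invr_gt0.
(* Parallelogram law: the linear terms of [J] cancel. As the midpoint value is at least [m], two
   near-minimal points are close. *)
have para x y : '[x - y, x - y] = 2 * J x + 2 * J y - 4 * J ((2^-1)%:C *: (x + y)).
  by rewrite /J fZ fD !ripE (ripC y x); field.
have cau (e : R) : 0 < e -> exists M : nat, forall m n : nat,
    (M <= m)%N -> (M <= n)%N -> N (u m - u n) < e.
  move=> e0.
  have [K] := @ltr_add_invr R 0 (e ^+ 2 / 4) ltac:(by rewrite divr_gt0 ?exprn_gt0).
  rewrite add0r => hK.
  exists K => i j Ki Kj.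
  have inv n : (K <= n)%N -> n.+1%:R^-1 <= K.+1%:R^-1 :> R.
    by move=> Kn; rewrite lef_pV2 ?posrE // ler_nat.
  rewrite -(ltr_pXn2r (n := 2)) // ?nnegrE ?hnorm_ge0 ?ltW //.
  rewrite hnorm_sqr para.
  have := hu i; have := hu j; have := inv i Ki; have := inv j Kj.
  have := mJ ((2^-1)%:C *: (u i + u j)).
  by move: hK; move: (K.+1%:R^-1) (i.+1%:R^-1) (j.+1%:R^-1) => a b c; lra.
case: hilbert => _ _ _ _ /(_ u cau)[l hl].
have Jl : J l <= m.
  rewrite leNgt; apply/negP => Jl.
  have M0 : 0 <= 2 * `|M| + 2 * N l + 1 by have := hnorm_ge0 l; have := normr_ge0 M; lra.
  (* The denominator bounds how fast [J] can drop away from [l], plus 1 for positivity: within this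
     distance [J] stays above [J l] minus half the gap [J l - m]. *)
  have d0 : 0 < (J l - m) / 2 / (2 * `|M| + 2 * N l + 1).
    rewrite divr_gt0 //; first lra.
    by have := hnorm_ge0 l; have := normr_ge0 M; lra.
  have [A hA] := hl _ d0.
  have [B] := @ltr_add_invr R 0 ((J l - m) / 2) ltac:(lra).
  rewrite add0r => hB.
  have := hA (A + B)%N (leq_addr _ _); rewrite ltr_pdivlMr; last first.
    by have := hnorm_ge0 l; have := normr_ge0 M; lra.
  have : (A + B).+1%:R^-1 <= B.+1%:R^-1 :> R by rewrite lef_pV2 ?posrE // ler_nat ltnS leq_addl.
  have := hu (A + B)%N; set v := u _.
  have -> : J v = '[v - l, v - l] + 2 * '[v - l, l] + '[l, l] - 2 * f (v - l) - 2 * f l.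
    by rewrite /J fD fN !ripE (ripC l v); ring.
  have := fM (v - l); have := ler_norm (f (v - l)).
  have := cauchy_schwarz (v - l) l; have := ler_norm (- '[v - l, l]); rewrite normrN.
  have := rip_ge0 (v - l); have := hnorm_ge0 (v - l).
  have : M * N (v - l) <= `|M| * N (v - l) by apply: ler_wpM2r; [exact: hnorm_ge0 | exact: ler_norm].
  have : J l = '[l, l] - 2 * f l by [].
  by move: hB Jl; move: (J l) (B.+1%:R^-1) ((A + B).+1%:R^-1) => a b c; lra.
exists l => y.
(* First variation: [J (l - t y) - J l] is a nonnegative quadratic in [t] without constant term, so
   its linear coefficient vanishes. *)
suff : (f y - '[y, l]) ^+ 2 <= 0 * '[y, y].
  rewrite mul0r => h; have /eqP : (f y - '[y, l]) ^+ 2 = 0 by apply: le_anti; rewrite h sqr_ge0.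
  by rewrite sqrf_eq0 subr_eq0 => /eqP.
apply: discr_bound => t.
have := mJ (l - t%:C *: y).
have : J (l - t%:C *: y) = J l + 2 * t * (f y - '[y, l]) + t ^+ 2 * '[y, y].
  by rewrite /J fD fN fZ !ripE (ripC l y); ring.
lra.
Qed.

(** Riesz applied to [x |-> '[T x, y]] defines [Ta y]; the bound comes from ['[Ta x, Ta x] =
    '[T (Ta x), x]] and Cauchy-Schwarz. *)
Lemma adjoint (T : {linear H -> H}) (M : R) : (forall x, N (T x) <= M * N x) ->
  exists Ta : {linear H -> H}, (forall x y, '[T x, y] = '[x, Ta y]) /\
    (forall x, N (Ta x) <= M * N x).
Proof.
move=> TM.
have /choice[f hf] y : exists l, forall x, '[T x, y] = '[x, l].
  apply: (@riesz _ (M * N y)) => [x x'|r x|x].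
  - by rewrite linearD ripDl.
  - by rewrite linearZ ripZl.
  - apply: le_trans (cauchy_schwarz _ _) _.
    by rewrite mulrAC; apply: ler_wpM2r; [exact: hnorm_ge0 | exact: TM].
have [Ta TaE] : exists Ta : {linear H -> H}, Ta =1 f.
  apply: linear_pack => a x y; apply: eq_from_rip => z.
  rewrite -hf !ripDr -!hf; congr (_ + _).
  have conjK : (a^*)^* = a by case: a => a1 a2 /=; rewrite opprK.
  by rewrite -[in LHS]conjK -[in RHS]conjK -!ripJ -linearZ hf.
exists Ta; split=> [x y|x]; rewrite TaE ?hf //.
have := cauchy_schwarz (T (f x)) x; rewrite hf -hnorm_sqr.
have := ler_norm (N (f x) ^+ 2).
have := TM (f x); have := hnorm_ge0 x; have := hnorm_ge0 (f x).
have := TM x; have := hnorm_ge0 (T x).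
have [->|] := eqVneq (N (f x)) 0; first by lra.
rewrite neq_lt => /orP[|fx0]; first lra.
move=> ? ? ? ? h ? h'; rewrite -(ler_pM2l fx0).
have : N (T (f x)) * N x <= M * N (f x) * N x by apply: ler_wpM2r.
lra.
Qed.

(** Cauchy-Schwarz for the form of [X] at [x] and [X x] gives [|X x|^4 <= '[X x, x] '[X (X x), X x]
    <= q^2 |x|^2 |X x|^2]. *)
Lemma psd_norm_le (X : {linear H -> H}) (q : R) : 0 <= q ->
  (forall x y, '[X x, y] = '[x, X y]) ->
  (forall x, 0 <= '[X x, x] <= q * '[x, x]) -> forall x, N (X x) <= q * N x.
Proof.
move=> q0 sX hX x.
have pX y : 0 <= '[X y, y] by case/andP: (hX y).
have qX y : '[X y, y] <= q * '[y, y] by case/andP: (hX y).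
apply: hnorm_le; first by rewrite mulr_ge0 ?hnorm_ge0.
have := psd_cauchy_schwarz x (X x) sX pX.
rewrite exprMn hnorm_sqr.
have : '[X x, x] * '[X (X x), X x] <= (q * '[x, x]) * (q * '[X x, X x]).
  by apply: ler_pM => //; apply: qX.
have [->|] := eqVneq '[X x, X x] 0; first by rewrite mulr_ge0 ?exprn_ge0 ?rip_ge0.
rewrite neq_lt => /orP[|x0]; first by have := rip_ge0 (X x); lra.
by move=> h1 h2; rewrite -(ler_pM2r x0); move: h1 h2; rewrite !expr2; lra.
Qed.

(** * Square roots and unitary extensions *)

Section SquareRoot.
Variables (X : {linear H -> H}) (r : R).
Hypotheses (r0 : 0 <= r) (r1 : r < 1).
Hypothesis X_sym : forall x y, '[X x, y] = '[x, X y].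
Hypothesis X_le : forall x, N (X x) <= (2 * r - r ^+ 2) * N x.

(** The classical iteration for the square root of [1 - X], started at 0. The bound [2 r - r^2] on
    [X] is the one for which the ball of radius [r] is mapped into itself, since half of
    [(2 r - r^2) + r^2] is [r]. *)
Let step (T : {linear H -> H}) : {linear H -> H} := (2^-1)%:C \*: (X \+ (T \o T)).
Let Y n : {linear H -> H} := iter n step \0.

Let N_half x : N ((2^-1)%:C *: x) = 2^-1 * N x.
Proof. by rewrite hnormZr ger0_norm // invr_ge0. Qed.

Let YS n x : Y n.+1 x = (2^-1)%:C *: (X x + Y n (Y n x)).
Proof. by []. Qed.

Let Y_le n x : N (Y n x) <= r * N x.
Proof.
elim: n x => [|n IH] x; first by rewrite /= hnorm0 mulr_ge0 ?hnorm_ge0.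
rewrite YS N_half.
have := hnormD (X x) (Y n (Y n x)); have := X_le x; have := IH (Y n x).
have := ler_wpM2l r0 (IH x); have := hnorm_ge0 x; rewrite expr2; lra.
Qed.

Let Y_sym n x y : '[Y n x, y] = '[x, Y n y].
Proof.
elim: n x y => [|n IH] x y; first by rewrite /= rip0l rip0r.
by rewrite !YS !ripE X_sym !IH.
Qed.

(** With [Z = Y n.+1] and [Y = Y n], [Z^2 - Y^2 = (Z - Y) Z + Y (Z - Y)]. Each summand contributes a
    factor [r], and the factor 1/2 absorbs their number. *)
Let Y_diff n x : N (Y n.+1 x - Y n x) <= N x * r ^+ n.
Proof.
elim: n x => [|n IH] x.
  rewrite YS /= subr0 addr0 N_half expr0 mulr1.
  have := X_le x; have : (2 * r - r ^+ 2) * N x <= 1 * N x.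
    apply: ler_wpM2r; first exact: hnorm_ge0.
    have := sqr_ge0 (1 - r); rewrite sqrrB; lra.
  have := hnorm_ge0 x; lra.
rewrite 2!YS -scalerBr N_half opprD addrACA subrr add0r.
have -> : Y n.+1 (Y n.+1 x) - Y n (Y n x) =
    (Y n.+1 (Y n.+1 x) - Y n (Y n.+1 x)) + Y n (Y n.+1 x - Y n x).
  by rewrite linearB addrA subrK.
have := hnormD (Y n.+1 (Y n.+1 x) - Y n (Y n.+1 x)) (Y n (Y n.+1 x - Y n x)).
have := IH (Y n.+1 x); have := Y_le n (Y n.+1 x - Y n x).
have := ler_wpM2l r0 (IH x).
have := ler_wpM2r (exprn_ge0 n r0) (Y_le n.+1 x); rewrite exprS; lra.
Qed.

(* The fixed point Z satisfies (1 - Z)^2 = 1 - X. *)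
Lemma quadratic_fixpoint : exists Z : {linear H -> H},
  [/\ forall x y, '[Z x, y] = '[x, Z y], forall x, N (Z x) <= r * N x &
      forall x, Z x = (2^-1)%:C *: (X x + Z (Z x))].
Proof.
have /choice[f hf] x : exists l, forall n, N (Y n x - l) <= N x / (1 - r) * r ^+ n.
  exact: (@geometric_limit (Y^~ x) _ _ (hnorm_ge0 x) r0 r1 (Y_diff^~ x)).
have hf' n x : N (f x - Y n x) <= N x / (1 - r) * r ^+ n by rewrite hnormB; apply: hf.
have f_le x : N (f x) <= r * N x.
  rewrite -subr_le0; apply: (le0_of_geometric r0 r1 (K := N x / (1 - r))) => n.
  have := hnormD (f x - Y n x) (Y n x); rewrite subrK.
  have := Y_le n x; have := hf' n x; lra.
have [Z ZE] : exists Z : {linear H -> H}, Z =1 f.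
  apply: linear_pack => a x y; apply/eqP; rewrite -subr_eq0; apply/eqP/hnorm_eq0.
  have [c c0 hc] := hnormZ_le a.
  apply: (le0_of_geometric r0 r1 (K := (N (a *: x + y) + c * N x + N y) / (1 - r))) => n.
  have -> : f (a *: x + y) - (a *: f x + f y) = (f (a *: x + y) - Y n (a *: x + y))
      + (a *: (Y n x - f x) + (Y n y - f y)).
    by rewrite (linearP (Y n)) scalerBr [a *: _ - _ + _]addrACA -opprD addrA subrK.
  have := hnormD (f (a *: x + y) - Y n (a *: x + y)) (a *: (Y n x - f x) + (Y n y - f y)).
  have := hnormD (a *: (Y n x - f x)) (Y n y - f y).
  have := hc (Y n x - f x); have := ler_wpM2l c0 (hf x n).
  have := hf y n; have := hf' n (a *: x + y).
  rewrite !mulrDl; lra.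
exists Z; split => [x y|x|x]; rewrite !ZE //.
- apply/eqP; rewrite -subr_eq0 -normr_le0.
  apply: (le0_of_geometric r0 r1 (K := 2 * N x * N y / (1 - r))) => n.
  have -> : '[f x, y] - '[x, f y] = '[f x - Y n x, y] - '[x, f y - Y n y].
    by rewrite !ripE Y_sym; ring.
  apply: le_trans (ler_normB _ _) _.
  have := cauchy_schwarz (f x - Y n x) y; have := cauchy_schwarz x (f y - Y n y).
  have := ler_wpM2l (hnorm_ge0 x) (hf' n y).
  have := ler_wpM2r (hnorm_ge0 y) (hf' n x); lra.
- apply/eqP; rewrite -subr_eq0; apply/eqP/hnorm_eq0.
  apply: (le0_of_geometric r0 r1 (K := 2 * N x / (1 - r))) => n.
  have -> : f x - (2^-1)%:C *: (X x + f (f x)) = (f x - Y n.+1 x)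
      + (2^-1)%:C *: (Y n (Y n x - f x) + (Y n (f x) - f (f x))).
    rewrite YS (linearB (Y n)) [_ + (_ - f (f x))]addrA subrK -[RHS]addrA; congr (_ + _).
    rewrite -scalerN [RHS]addrC -scalerBr; congr (_ *: _).
    by rewrite [X x + Y n _]addrC !opprD addrACA subrr add0r addrC.
  have := hnormD (f x - Y n.+1 x)
      ((2^-1)%:C *: (Y n (Y n x - f x) + (Y n (f x) - f (f x)))).
  rewrite N_half.
  have := hnormD (Y n (Y n x - f x)) (Y n (f x) - f (f x)).
  have := hf' n.+1 x; have := Y_le n (Y n x - f x); have := hf x n; have := hf (f x) n.
  have E0 : 0 <= (1 - r)^-1 * r ^+ n by rewrite mulr_ge0 ?exprn_ge0 // invr_ge0 subr_ge0 ltW.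
  have := ler_wpM2r E0 (f_le x); have := ler_wpM2l r0 (hf x n).
  have : 0 <= (1 - r) * (N x * ((1 - r)^-1 * r ^+ n)).
    by rewrite !mulr_ge0 ?hnorm_ge0 ?invr_ge0 ?exprn_ge0 // subr_ge0 ltW.
  rewrite exprS; lra.
Qed.

End SquareRoot.

(** Dividing by [M] turns [B] into [1 - X] with [0 <= X <= 1 - d / M]; the fixed point [Z] then
    gives [S = sqrt M (1 - Z)]. *)
Lemma positive_sqrt (B : {linear H -> H}) (d M : R) : 0 < d -> d <= M ->
  (forall x y, '[B x, y] = '[x, B y]) ->
  (forall x, d * '[x, x] <= '[B x, x] <= M * '[x, x]) ->
  exists S : {linear H -> H}, [/\ forall x y, '[S x, y] = '[x, S y],
    forall x, S (S x) = B x & forall y, exists x, S x = y].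
Proof.
move=> d0 dM sB hB.
have M0 : 0 < M by lra.
pose X : {linear H -> H} := idfun \- ((M^-1)%:C \*: B).
have XE x : X x = x - (M^-1)%:C *: B x by [].
have dM0 : 0 < d / M by apply: divr_gt0.
have dM1 : d / M <= 1 by rewrite ler_pdivrMr ?mul1r.
have sM0 : 0 < Num.sqrt (d / M) by rewrite sqrtr_gt0.
have sMsq : Num.sqrt (d / M) ^+ 2 = d / M by rewrite sqr_sqrtr // ltW.
(* This [r] solves [2 r - r^2 = 1 - d / M]; positivity of [d] makes it less than 1. *)
pose r := 1 - Num.sqrt (d / M).
have r1 : r < 1 by rewrite /r; lra.
have r0 : 0 <= r.
  by rewrite subr_ge0 -[1]sqrtr1 ler_sqrt.
have rE : 2 * r - r ^+ 2 = 1 - d / M by rewrite -sMsq /r; ring.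
have sX x y : '[X x, y] = '[x, X y] by rewrite !XE !ripE sB.
have Xle : forall x, N (X x) <= (2 * r - r ^+ 2) * N x.
  apply: psd_norm_le => // [|x]; first by rewrite rE; lra.
  rewrite rE XE !ripE; case/andP: (hB x) => h1 h2.
  have M'0 : 0 <= M^-1 by rewrite invr_ge0 ltW.
  have := ler_wpM2l M'0 h1; have := ler_wpM2l M'0 h2.
  rewrite [M^-1 * (M * _)]mulrA mulVf ?gt_eqF // mul1r => ? ?.
  by apply/andP; split; lra.
have [Z [sZ Zle ZE]] := quadratic_fixpoint r0 r1 sX Xle.
pose s := Num.sqrt M.
have s2 : s * s = M by rewrite -expr2 sqr_sqrtr // ltW.
have s_neq0 : s != 0 by rewrite gt_eqF // sqrtr_gt0.
pose S : {linear H -> H} := s%:C \*: (idfun \- Z).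
have SE x : S x = s%:C *: (x - Z x) by [].
exists S; split => [x y|x|y].
- by rewrite !SE !ripE sZ.
- rewrite !SE (linearZ_LR Z) -scalerBr scalerA -rmorphM s2 (linearB Z).
  have ZZ : Z (Z x) = Z x + Z x - X x.
    rewrite -mulr2n -scaler_nat [in X in _ = X]ZE scalerA.
    have -> : 2%:R * (2^-1)%:C = 1 :> R[i].
      by rewrite -(rmorph_nat (real_complex R)) -rmorphM mulfV // pnatr_eq0.
    by rewrite scale1r addrAC subrr add0r.
  rewrite ZZ opprB [_ + _ - X x - _]addrAC addrK addrA subrK XE opprB addrC subrK.
  by rewrite scalerA -rmorphM mulfV ?gt_eqF // scale1r.
(* Neumann series: these are the partial sums for [x = s^-1 y + Z x], which converge because [Z] has
   norm at most [r < 1]. *)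
- pose v n := iter n (fun x => (s^-1)%:C *: y + Z x) 0.
  have vS n : v n.+1 = (s^-1)%:C *: y + Z (v n) by [].
  have v_diff n : N (v n.+1 - v n) <= N ((s^-1)%:C *: y) * r ^+ n.
    elim: n => [|n IH]; first by rewrite vS /= linear0 addr0 subr0 expr0 mulr1.
    rewrite 2!vS opprD addrACA subrr add0r -(linearB Z).
    by have := Zle (v n.+1 - v n); have := ler_wpM2l r0 IH; rewrite exprS; lra.
  have [l hl] := geometric_limit (hnorm_ge0 ((s^-1)%:C *: y)) r0 r1 v_diff.
  suff lE : l = (s^-1)%:C *: y + Z l.
    by exists l; rewrite SE {1}lE addrK scalerA -rmorphM mulfV // scale1r.
  apply/eqP; rewrite -subr_eq0; apply/eqP/hnorm_eq0.
  apply: (le0_of_geometric r0 r1 (K := 2 * (N ((s^-1)%:C *: y) / (1 - r)))) => n.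
  have -> : l - ((s^-1)%:C *: y + Z l) = (l - v n.+1) + Z (v n - l).
    by rewrite vS (linearB Z) addrA [in RHS]opprD [in RHS]addrA subrK opprD addrA.
  have := hnormD (l - v n.+1) (Z (v n - l)); rewrite (hnormB l).
  have := Zle (v n - l); have := hl n.+1; have := ler_wpM2l r0 (hl n).
  have : 0 <= (1 - r) * (N ((s^-1)%:C *: y) / (1 - r) * r ^+ n).
    by rewrite !mulr_ge0 ?exprn_ge0 ?hnorm_ge0 ?invr_ge0 // subr_ge0 ltW.
  rewrite exprS; lra.
Qed.

(** [D] is the square root of [1 - Ta T]. Its surjectivity comes from the lower bound [1 - q^2 > 0]
    of that operator. *)
Lemma defect_operator (T : {linear H -> H}) (q : R) : 0 <= q -> q < 1 ->
  (forall x, N (T x) <= q * N x) ->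
  exists D : {linear H -> H}, (forall x, '[D x, D x] = '[x, x] - '[T x, T x]) /\
    (forall y, exists x, D x = y).
Proof.
move=> q0 q1 Tq; have [Ta [TaE _]] := adjoint Tq.
pose B : {linear H -> H} := idfun \- (Ta \o T).
have BE x y : '[B x, y] = '[x, y] - '[T x, T y].
  by rewrite -[B x]/(x - Ta (T x)) !ripE (ripC (Ta _)) -TaE (ripC (T y)).
have q2 : q ^+ 2 < 1 by rewrite expr2; nra.
have [||x y|x|S [sS SS surjS]] := @positive_sqrt B (1 - q ^+ 2) 1.
- lra.
- by have := sqr_ge0 q; lra.
- by rewrite (ripC x) !BE (ripC x) (ripC (T x)).
- rewrite BE mul1r.
  have : '[T x, T x] <= q ^+ 2 * '[x, x].
    by rewrite -!hnorm_sqr -exprMn lerXn2r ?nnegrE ?mulr_ge0 ?hnorm_ge0.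
  by have := rip_ge0 (T x) => ? ?; apply/andP; split; lra.
by exists S; split=> // x; rewrite -sS SS BE.
Qed.

(** * Unitaries onto graphs and the extension of the defect isometry *)

Local Notation HH := (H * H)%type.

Definition pair_norm2 (p : HH) : R := '[p.1, p.1] + '[p.2, p.2].

(* With A = Q P^-1, the complement of the graph {(x, A x)} is {(- A^* y, y)}, which
   is parametrised isometrically through the square root of 1 + A A^*. *)
Lemma unitary_onto_graph (P Q E : {linear H -> H}) (c M : R) : 0 < c ->
  (forall x, c * N x <= N (P x)) -> (forall x, N (Q x) <= M * N x) ->
  (forall y, exists x, P x = y) -> (forall y, exists x, E x = y) ->
  (forall x, '[E x, E x] = '[P x, P x] + '[Q x, Q x]) ->
  exists W : {linear HH -> HH}, [/\ forall p, pair_norm2 (W p) = pair_norm2 p,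
    forall p, exists p', W p' = p & forall x, W (E x, 0) = (P x, Q x)].
Proof.
move=> c0 cP QM surjP surjE EPQ.
have Pinj x : P x = 0 -> x = 0.
  move=> Px0; apply: hnorm_eq0; have := cP x; rewrite Px0 hnorm0.
  by rewrite pmulr_rle0.
have Einj x : E x = 0 -> x = 0.
  move=> Ex0; apply/Pinj/rip_eq0; have := EPQ x; rewrite Ex0 rip0l.
  by have := rip_ge0 (P x); have := rip_ge0 (Q x); lra.
have [P' [PK PK']] := linear_inverse Pinj surjP.
have [E' [EK EK']] := linear_inverse Einj surjE.
pose A : {linear H -> H} := Q \o P'.
have AE x : A (P x) = Q x by rewrite /A /= PK.
have Mc0 : 0 <= `|M| / c by rewrite divr_ge0 // ltW.
have A_le x : N (A x) <= `|M| / c * N x.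
  rewrite -{2}(PK' x) mulrAC ler_pdivlMr //.
  have := ler_wpM2l (normr_ge0 M) (cP (P' x)).
  have := ler_wpM2r (ltW c0) (QM (P' x)).
  have := ler_wpM2r (ltW c0) (ler_wpM2r (hnorm_ge0 (P' x)) (ler_norm M)).
  rewrite -[A x]/(Q (P' x)); lra.
have [Aa [AaE Aa_le]] := adjoint A_le.
pose B : {linear H -> H} := idfun \+ (A \o Aa).
have BE x y : '[B x, y] = '[x, y] + '[Aa x, Aa y].
  by rewrite -[B x]/(x + A (Aa x)) !ripE AaE.
have [||x y|x|S [sS SS surjS]] := @positive_sqrt B 1 (1 + (`|M| / c) ^+ 2).
- lra.
- by have := sqr_ge0 (`|M| / c); lra.
- by rewrite (ripC x) !BE (ripC x) (ripC (Aa x)).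
- rewrite BE mul1r mulrDl mul1r.
  have : '[Aa x, Aa x] <= (`|M| / c) ^+ 2 * '[x, x].
    by rewrite -!hnorm_sqr -exprMn lerXn2r ?nnegrE ?(mulr_ge0 Mc0) ?hnorm_ge0.
  by have := rip_ge0 (Aa x) => ? ?; apply/andP; split; lra.
have S_norm x : '[S x, S x] = '[x, x] + '[Aa x, Aa x] by rewrite -sS SS BE.
have Sinj x : S x = 0 -> x = 0.
  move=> Sx0; apply: rip_eq0; have := S_norm x; rewrite Sx0 rip0l.
  by have := rip_ge0 (Aa x); have := rip_ge0 x; lra.
have [S' [SK SK']] := linear_inverse Sinj surjS.
(* The pair [(E x, S y)] is sent to [(P x, Q x)] in the graph plus [(- Aa y, y)] in its
   complement. *)
have [W WE] : exists W : {linear HH -> HH},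
    W =1 fun p => (P (E' p.1) - Aa (S' p.2), Q (E' p.1) + S' p.2).
  apply: linear_pack => a [x1 x2] [y1 y2]; congr (_, _) => /=.
    rewrite (linearP E') (linearP S') (linearP P) (linearP Aa) /=.
    by rewrite scalerBr opprD [RHS]addrACA.
  rewrite (linearP E') (linearP S') (linearP Q) /=.
  by rewrite scalerDr [RHS]addrACA.
exists W; split => [[u z]|[p q]|x]; rewrite ?WE /=.
- rewrite /pair_norm2 /= -[u in RHS]EK' -[z in RHS]SK' EPQ S_norm !ripE.
  (* The cross terms cancel: ['[P x, Aa y] = '[A (P x), y] = '[Q x, y]]. *)
  rewrite (ripC (Aa _) (P _)) (ripC (S' z) (Q _)) -AaE AE; ring.
(* Inverting [S] twice solves [B y = q - A p]; the graph point over [p + Aa y] then completes the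
   preimage. *)
- have [y1 Sy1] := surjS (q - A p); have [y Sy] := surjS y1.
  exists (E (P' (p + Aa y)), S y); rewrite WE /= EK SK PK' addrK; congr (_, _).
  rewrite -[Q _]/(A _) linearD -addrA [A _ + y]addrC -[y + _]/(B y) -SS Sy Sy1.
  by rewrite addrC subrK.
- by rewrite EK (linear0 S') (linear0 Aa) subr0 addr0.
Qed.

(** With [D] the defect operator of [T1 T2], [W1] sends [(D x, 0)] to [(D2 x, D1 (T2 x))] and [W2]
    sends it to [(D1 x, D2 (T1 x))]. Then [U] is the inverse of [W1], followed by [W2] and the swap
    of coordinates. *)
Lemma ando_unitary (T1 T2 : {linear H -> H}) (q1 q2 : R) :
  0 <= q1 -> q1 < 1 -> 0 <= q2 -> q2 < 1 ->
  (forall x, N (T1 x) <= q1 * N x) -> (forall x, N (T2 x) <= q2 * N x) ->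
  (forall x, T1 (T2 x) = T2 (T1 x)) ->
  exists (D1 D2 : {linear H -> H}) (U U' : {linear HH -> HH}),
  [/\ (forall x, '[D1 x, D1 x] = '[x, x] - '[T1 x, T1 x]) /\
        (forall y, exists x, D1 x = y),
      (forall x, '[D2 x, D2 x] = '[x, x] - '[T2 x, T2 x]) /\
        (forall y, exists x, D2 x = y),
      cancel U U' /\ cancel U' U,
      forall p, pair_norm2 (U p) = pair_norm2 p &
      forall x, U (D2 x, D1 (T2 x)) = (D2 (T1 x), D1 x)].
Proof.
move=> q10 q11 q20 q21 T1q T2q TT.
have [D1 [D1E D1s]] := defect_operator q10 q11 T1q.
have [D2 [D2E D2s]] := defect_operator q20 q21 T2q.
have Tq x : N ((T1 \o T2) x) <= q1 * q2 * N x.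
  by rewrite -mulrA; apply: le_trans (T1q _) _; apply: ler_wpM2l.
have qq1 : q1 * q2 < 1 by nra.
have [D [DE Ds]] := defect_operator (T := T1 \o T2) (mulr_ge0 q10 q20) qq1 Tq.
have D_le (T D0 : {linear H -> H}) x :
    (forall x, '[D0 x, D0 x] = '[x, x] - '[T x, T x]) -> N (D0 x) <= N x.
  move=> E; apply: hnorm_le; first exact: hnorm_ge0.
  by rewrite E hnorm_sqr; have := rip_ge0 (T x); lra.
have D_ge (T D0 : {linear H -> H}) (q : R) x :
    0 <= q -> q < 1 -> (forall x, N (T x) <= q * N x) ->
    (forall x, '[D0 x, D0 x] = '[x, x] - '[T x, T x]) -> (1 - q) * N x <= N (D0 x).
  move=> q0 q1' Tq' E.
  rewrite -(ler_pXn2r (n := 2)) // ?nnegrE ?mulr_ge0 ?hnorm_ge0 ?subr_ge0 ?(ltW q1') //.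
  rewrite exprMn (hnorm_sqr (D0 x)) E -!hnorm_sqr.
  have : N (T x) ^+ 2 <= (q * N x) ^+ 2.
    by rewrite lerXn2r ?nnegrE ?mulr_ge0 ?hnorm_ge0.
  (* Used through [(1 - q^2) - (1 - q)^2 = 2 q (1 - q)]. *)
  have : 0 <= q * (1 - q) * N x ^+ 2 by rewrite mulr_ge0 ?sqr_ge0 // mulr_ge0 // subr_ge0 ltW.
  rewrite exprMn; lra.
have [|x|x|||x|W1 [W1n W1s W1E]] := @unitary_onto_graph D2 (D1 \o T2) D (1 - q2) q2;
  rewrite ?subr_gt0 //.
- exact: D_ge D2E.
- exact: le_trans (D_le _ _ _ D1E) _.
- by rewrite DE D2E /= D1E; ring.
(* [D1] takes the first place because the first entry of the graph must be invertible; the swap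
   restores the order. *)
have [|x|x|||x|W2 [W2n W2s W2E]] := @unitary_onto_graph D1 (D2 \o T1) D (1 - q1) q1;
  rewrite ?subr_gt0 //.
- exact: D_ge D1E.
- exact: le_trans (D_le _ _ _ D2E) _.
- by rewrite DE D1E /= D2E /= TT; ring.
have pinj (W : {linear HH -> HH}) :
    (forall p, pair_norm2 (W p) = pair_norm2 p) -> forall p, W p = 0 -> p = 0.
  move=> Wn [x y] Wp; have := Wn (x, y); rewrite Wp /pair_norm2 /= rip0l.
  have := rip_ge0 x; have := rip_ge0 y => ? ? ?.
  by congr (_, _); apply: rip_eq0; lra.
have [W1' [W1K W1K']] := linear_inverse (pinj _ W1n) W1s.
have [W2' [W2K W2K']] := linear_inverse (pinj _ W2n) W2s.
have [sw swE] : exists s : {linear HH -> HH}, s =1 fun p => (p.2, p.1).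
  by apply: linear_pack => a [x1 x2] [y1 y2].
exists D1, D2, (sw \o (W2 \o W1')), (W1 \o (W2' \o sw)); split=> //.
- by split=> [[x y]|[x y]]; rewrite /= !swE /= -?surjective_pairing ?W2K ?W1K' // W1K W2K'.
- move=> p; rewrite /= swE -[in RHS](W1K' p) W1n -(W2n (W1' p)).
  by rewrite /pair_norm2 /= addrC.
- by move=> x; rewrite /= -W1E W1K swE W2E.
Qed.

End RealInnerProduct.

(** * The dilation *)

(** Boundedness makes the supremum in [opnorm] a genuine upper bound on the unit ball; rescaling a
    nonzero [x] extends the estimate to all vectors. *)
Lemma opnorm_bound (R : realType) (H : lmodType R[i]) (ip : H -> H -> R[i])
    (T : {linear H -> H}) : is_hilbert_space ip -> bounded_op ip T ->
  0 <= opnorm ip T /\ forall x, hnorm ip (T x) <= opnorm ip T * hnorm ip x.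
Proof.
move=> hilbert [M TM].
have ub : has_ubound [set hnorm ip (T x) | x in [set x : H | hnorm ip x <= 1]]%classic.
  exists `|M| => _ [x /= x1 <-]; apply: le_trans (TM x) _.
  apply: le_trans (ler_wpM2r (hnorm_ge0 ip x) (ler_norm M)) _.
  by rewrite -[leRHS]mulr1; apply: ler_wpM2l.
have T1 x : hnorm ip x <= 1 -> hnorm ip (T x) <= opnorm ip T.
  by move=> x1; apply: ub_le_sup => //; exists x.
split=> [|x].
  by apply: le_trans (T1 0 _); [exact: hnorm_ge0 | rewrite hnorm0].
have [x0|] := eqVneq (hnorm ip x) 0.
  have -> : x = 0 by apply: (hnorm_eq0 hilbert); rewrite x0.
  by rewrite linear0 hnorm0 // mulr0.
move=> x_neq0.
have x0 : 0 < hnorm ip x by rewrite lt_neqAle eq_sym x_neq0; exact: hnorm_ge0.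
have := T1 (((hnorm ip x)^-1)%:C *: x).
rewrite linearZ_LR !(hnormZr hilbert) ger0_norm ?invr_ge0 ?hnorm_ge0 // mulVf // => /(_ (lexx _)).
by rewrite mulrC ler_pdivrMr.
Qed.

(** Norm bookkeeping for the l_2 part: one coordinate stays, the other moves by one slot, and [d]
    fills the vacated slot 0. *)
Lemma nneseries_shift (R : realType) (d : R) (a b : nat -> R) :
  0 <= d -> (forall n, 0 <= a n) -> (forall n, 0 <= b n) ->
  (\sum_(0 <= n <oo) (a n + (if n is m.+1 then b m else d))%:E =
   d%:E + \sum_(0 <= n <oo) (a n + b n)%:E)%E.
Proof.
move=> d0 a0 b0; pose c n := if n is m.+1 then b m else d.
have c0 n : 0 <= c n by case: n => [|n] /=.
under eq_eseriesr do rewrite EFinD.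
under [in RHS]eq_eseriesr do rewrite EFinD.
rewrite !nneseriesD; try by move=> n _ _; rewrite lee_fin; first [exact: a0 | exact: b0 | exact: (c0 n)].
rewrite addeCA; congr (_ + _)%E.
rewrite (@nneseries_recl _ xpredT (fun n => (c n)%:E)) //; last by move=> n _; rewrite lee_fin.
congr (_ + _)%E; rewrite -(nneseries_addn (f := fun n => (c n)%:E) 1); last by move=> n; rewrite lee_fin.
by apply: eq_eseriesr => n _; rewrite addn1.
Qed.

Section Dilation.
Variables (R : realType) (H : lmodType R[i]) (ip : H -> H -> R[i]).
Hypothesis hilbert : is_hilbert_space ip.
Local Notation HH := (H * H)%type.
Variables (T1 T2 D1 D2 : {linear H -> H}) (U U' : {linear HH -> HH}).
Hypothesis TC : forall x, T1 (T2 x) = T2 (T1 x).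
Hypothesis D1E : forall x, rip ip (D1 x) (D1 x) = rip ip x x - rip ip (T1 x) (T1 x).
Hypothesis D2E : forall x, rip ip (D2 x) (D2 x) = rip ip x x - rip ip (T2 x) (T2 x).
Hypothesis D1_surj : forall y, exists x, D1 x = y.
Hypothesis D2_surj : forall y, exists x, D2 x = y.
Hypotheses (UK : cancel U U') (UK' : cancel U' U).
Hypothesis U_isom : forall p, pair_norm2 ip (U p) = pair_norm2 ip p.
Hypothesis U_defect : forall x, U (D2 x, D1 (T2 x)) = (D2 (T1 x), D1 x).

(** * The two maps and their commutation *)

(** Both maps are defined on all sequences, square-summable or not, so linearity and commutation are
    coordinatewise identities. *)
Definition dil1 (k : KT H) : KT H :=
  (T1 k.1, fun n => U ((k.2 n).1, if n is m.+1 then (k.2 m).2 else D1 k.1)).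

Definition dil2 (k : KT H) : KT H :=
  (T2 k.1, fun n => (if n is m.+1 then (U' (k.2 m)).1 else D2 k.1, (U' (k.2 n)).2)).

Lemma dil1_is_linear : linear dil1.
Proof.
move=> a k l; congr (_, _); first exact: linearP.
apply/funext => n; rewrite /= -[RHS]linearP; congr (U (_, _)).
by case: n => [|n] //=; exact: linearP.
Qed.
HB.instance Definition _ := GRing.isLinear.Build _ _ _ _ dil1 dil1_is_linear.

Lemma dil2_is_linear : linear dil2.
Proof.
move=> a k l; congr (_, _); first exact: linearP.
apply/funext => n; congr (_, _); last by rewrite /= (linearP U').
by case: n => [|n] /=; rewrite ?(linearP U') ?(linearP D2).
Qed.
HB.instance Definition _ := GRing.isLinear.Build _ _ _ _ dil2 dil2_is_linear.

(** In slot 0 this is exactly the prescribed value of [U] on [(D2 h, D1 (T2 h))]; in later slots [U]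
    undoes [U']. *)
Lemma dil12E k : dil1 (dil2 k) =
  (T1 (T2 k.1), fun n => if n is m.+1 then k.2 m else (D2 (T1 k.1), D1 k.1)).
Proof.
congr (_, _); apply/funext => -[|n] /=; first exact: U_defect.
exact: etrans (congr1 U (esym (surjective_pairing (U' (k.2 n))))) (UK' _).
Qed.

Lemma dil21E k : dil2 (dil1 k) =
  (T1 (T2 k.1), fun n => if n is m.+1 then k.2 m else (D2 (T1 k.1), D1 k.1)).
Proof.
rewrite TC; congr (_, _); apply/funext => -[|n] /=; first by rewrite UK.
by rewrite !UK; exact: esym (surjective_pairing (k.2 n)).
Qed.

Lemma dil_comm k : dil1 (dil2 k) = dil2 (dil1 k).
Proof. by rewrite dil12E dil21E. Qed.

(** * Isometry and dilation properties *)

Let tail_series (k : KT H) := (\sum_(0 <= n <oo) (tail_norm2 ip k n)%:E)%E.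

Let hnorm2_ge0 x : 0 <= hnorm2 ip x. Proof. exact: rip_ge0. Qed.

Let tail_norm2_ge0 k n : 0 <= tail_norm2 ip k n.
Proof. by rewrite addr_ge0. Qed.

Lemma dil1_tail k :
  tail_series (dil1 k) = ((hnorm2 ip (D1 k.1))%:E + tail_series k)%E.
Proof.
rewrite -[X in (_ + X)%E]/(\sum_(0 <= n <oo)
  (hnorm2 ip (k.2 n).1 + hnorm2 ip (k.2 n).2)%:E)%E -nneseries_shift //.
apply: eq_eseriesr => n _; congr (_%:E).
rewrite -[LHS]/(pair_norm2 ip (U _)) U_isom /pair_norm2 /=.
by case: n.
Qed.

Lemma dil2_tail k :
  tail_series (dil2 k) = ((hnorm2 ip (D2 k.1))%:E + tail_series k)%E.
Proof.
(* The tail is measured in the coordinates given by [U'], listed in reverse because [dil2] shifts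
   the first one. *)
have -> : tail_series k = (\sum_(0 <= n <oo)
    (hnorm2 ip (U' (k.2 n)).2 + hnorm2 ip (U' (k.2 n)).1)%:E)%E.
  apply: eq_eseriesr => n _; congr (_%:E).
  rewrite -[LHS]/(pair_norm2 ip (k.2 n)) -[in LHS](UK' (k.2 n)) U_isom addrC.
  by [].
rewrite -nneseries_shift //.
apply: eq_eseriesr => n _; congr (_%:E).
by rewrite addrC; case: n.
Qed.

(** The tail gains [|D h|^2], which is what the head loses in passing from [h] to [T h]. *)
Let isometry_of_tail (V : {linear KT H -> KT H}) (T D : H -> H) :
  (forall k, (V k).1 = T k.1) ->
  (forall x, rip ip (D x) (D x) = rip ip x x - rip ip (T x) (T x)) ->
  (forall k, tail_series (V k) = ((hnorm2 ip (D k.1))%:E + tail_series k)%E) ->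
  K_isometry ip V.
Proof.
move=> V1 DE VE; have fin k : inK ip k -> tail_series k \is a fin_num.
  by move=> kK; rewrite ge0_fin_numE // nneseries_ge0 // => n _ _; rewrite lee_fin.
split=> [k kK|a k l _ _|k kK].
- by rewrite /inK -/(tail_series _) VE lte_add_pinfty // ltry.
- exact: linearP.
- congr Num.sqrt; rewrite /knorm2 -!/(tail_series _) VE fineD ?fin //= V1.
  by rewrite addrA; congr (_ + _); rewrite -!/(rip ip _ _) /hnorm2 -!/(rip ip _ _) DE; ring.
Qed.

Lemma dil1_isometry : K_isometry ip dil1.
Proof. exact: (@isometry_of_tail dil1 T1 D1 (fun _ => erefl) D1E dil1_tail). Qed.

Lemma dil2_isometry : K_isometry ip dil2.
Proof. exact: (@isometry_of_tail dil2 T2 D2 (fun _ => erefl) D2E dil2_tail). Qed.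

(** The head of each image depends on the head alone, through [T1] or [T2]. *)
Lemma dil_dilation : is_dilation T1 T2 dil1 dil2.
Proof.
move=> h s1 s2; congr (_, _); rewrite /mon2 /mon2H.
elim: s1 => [|s1 /= -> //] /=.
by elim: s2 => [|s2 /= ->].
Qed.

(** * Minimality *)

(** Sums without coefficients suffice, since a scalar can be absorbed into the vector of [H]; lists
    make concatenation serve as addition. *)
Definition spanned (k : KT H) : Prop := exists s : seq (H * nat * nat),
  k = \sum_(t <- s) mon2 dil1 dil2 t.1.2 t.2 (embedH t.1.1).

Let mon2N s1 s2 k : mon2 dil1 dil2 s1 s2 (- k) = - mon2 dil1 dil2 s1 s2 k.
Proof.
rewrite /mon2; have -> : iter s2 dil2 (- k) = - iter s2 dil2 k.
  by elim: s2 => //= s2 ->; rewrite (linearN dil2).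
by elim: s1 => //= s1 ->; rewrite (linearN dil1).
Qed.

Lemma spannedD k l : spanned k -> spanned l -> spanned (k + l).
Proof. by move=> [s ->] [t ->]; exists (s ++ t); rewrite big_cat. Qed.

Lemma spannedN k : spanned k -> spanned (- k).
Proof.
move=> [s ->]; exists [seq (- t.1.1, t.1.2, t.2) | t <- s].
rewrite big_map -sumrN; apply: eq_bigr => t _ /=; rewrite -mon2N; congr mon2.
by congr (_, _); apply/funext => n; rewrite /= oppr0.
Qed.

Lemma spanned_embedH h : spanned (embedH h).
Proof. by exists [:: (h, 0%N, 0%N)]; rewrite big_seq1. Qed.

Lemma spanned_dil1 k : spanned k -> spanned (dil1 k).
Proof.
move=> [s ->]; exists [seq (t.1.1, t.1.2.+1, t.2) | t <- s].
by rewrite big_map (linear_sum dil1).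
Qed.

(** Commutation carries the new factor past the powers of [dil1] to its place in [mon2]. *)
Lemma spanned_dil2 k : spanned k -> spanned (dil2 k).
Proof.
move=> [s ->]; exists [seq (t.1.1, t.1.2, t.2.+1) | t <- s].
rewrite big_map (linear_sum dil2); apply: eq_bigr => -[[h s1] s2] _ /=.
by rewrite /mon2; elim: s1 => //= s1 <-; rewrite dil_comm.
Qed.

Let single (n : nat) (p : HH) : KT H := (0, fun m => if m == n then p else 0).

Let spanned_single n p : spanned (single n p).
Proof.
elim: n => [|n IH]; last first.
  (* The head is 0, so nothing enters slot 0 and the product acts as a pure shift. *)
  suff -> : single n.+1 p = dil1 (dil2 (single n p)).
    exact/spanned_dil1/spanned_dil2.
  rewrite dil12E /single /= !linear0; congr (_, _).
  by apply/funext => -[|m].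
have U0 m : (if m == 0%N then 0 else 0) = 0 :> H by case: m.
have left a : spanned (single 0 (a, 0)).
  have [h <-] := D2_surj a.
  suff -> : single 0 (D2 h, 0) = dil2 (embedH h) - embedH (T2 h).
    by apply: spannedD; [apply/spanned_dil2/spanned_embedH | apply/spannedN/spanned_embedH].
  congr (_, _); first by rewrite /= subrr.
  by apply/funext => -[|m] /=; rewrite subr0 !(linear0 U').
have right b : spanned (single 0 (U (0, b))).
  have [h <-] := D1_surj b.
  suff -> : single 0 (U (0, D1 h)) = dil1 (embedH h) - embedH (T1 h).
    by apply: spannedD; [apply/spanned_dil1/spanned_embedH | apply/spannedN/spanned_embedH].
  congr (_, _); first by rewrite /= subrr.
  by apply/funext => -[|m] /=; rewrite subr0 // (linear0 U).
(* With [p = U (a, b)], the parts [U (a, 0)] and [U (0, b)] are treated separately. The second entry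
   of [(a, 0)] is 0, so [dil1] puts nothing into slot 1. *)
suff -> : single 0 p = dil1 (single 0 ((U' p).1, 0)) + single 0 (U (0, (U' p).2)).
  by apply: spannedD => //; apply: spanned_dil1.
congr (_, _); first by rewrite /= linear0 addr0.
apply/funext => -[|m] /=; last first.
  by rewrite -[RHS]/(U _ + 0) addr0; case: m => [|m]; exact: esym (linear0 U).
rewrite -[RHS]/(U ((U' p).1, D1 0) + U (0, (U' p).2)) (linear0 D1) -(linearD U) -[LHS]UK'; congr (U _).
by case: (U' p) => a b; congr (_, _); rewrite /= ?addr0 ?add0r.
Qed.

(** Truncations lie in the span itself, so density reduces to the smallness of tails of a convergent
    series. *)
Lemma spanned_truncation (k : KT H) N :
  spanned (k.1, fun n => if (n < N)%N then k.2 n else 0).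
Proof.
elim: N => [|N IH]; first exact: spanned_embedH.
suff -> : (k.1, fun n => if (n < N.+1)%N then k.2 n else 0) =
    ((k.1, fun n => if (n < N)%N then k.2 n else 0) : KT H) + single N (k.2 N).
  exact: spannedD.
congr (_, _); first by rewrite /= addr0.
apply/funext => n.
rewrite -[RHS]/((if (n < N)%N then k.2 n else 0) + (if n == N then k.2 N else 0)) /= ltnS leq_eqVlt.
by case: (ltngtP n N) => [| |->] /=; rewrite ?addr0 ?add0r.
Qed.

Lemma dil_minimal : is_minimal ip dil1 dil2.
Proof.
move=> k kK e e0.
pose f n := (tail_norm2 ip k n)%:E.
have f0 n : (0 <= f n)%E by rewrite lee_fin.
have [N hN] : exists N : nat, (\sum_(N <= n <oo) f n < (e ^+ 2)%:E)%E.
  have := @nneseries_tail_cvg _ f xpredT kK (fun n _ => f0 n).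
  move=> /fine_cvgP[[N0 _ fin] /cvgrPdist_lt /(_ (e ^+ 2) (exprn_gt0 _ e0))[N1 _ lt]].
  (* From [N0] on the tail is finite, and from [N1] on its real value is below [e ^+ 2]. *)
  exists (maxn N0 N1); have := lt (maxn N0 N1) (leq_maxr _ _).
  rewrite /= sub0r normrN => /(le_lt_trans (ler_norm _)).
  by rewrite -lte_fin fineK //; apply: fin; rewrite /= leq_maxl.
have [s sE] := spanned_truncation k N.
exists (size s), (fun _ => 1), (fun j => (tnth (in_tuple s) j).1.1),
  (fun j => (tnth (in_tuple s) j).1.2), (fun j => (tnth (in_tuple s) j).2).
under eq_bigr do rewrite scale1r.
rewrite -(big_tnth _ _ s xpredT (fun t => mon2 dil1 dil2 t.1.2 t.2 (embedH t.1.1))) -sE.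
rewrite -[ltRHS]ger0_norm ?(ltW e0) // -sqrtr_sqr ltr_sqrt ?exprn_gt0 //.
rewrite /knorm2 /= subrr [hnorm2 ip 0](rip0l hilbert) add0r.
set g := (X in fine X).
(* The truncation agrees with [k] in the head and in all slots below [N], so only the tail is
   left. *)
suff -> : g = (\sum_(N <= n <oo) f n)%E.
  rewrite -lte_fin fineK // ge0_fin_numE ?nneseries_ge0 //.
  by apply: lt_trans hN _; rewrite ltry.
rewrite /g (nneseries_split 0 N) => [|n _]; last by rewrite lee_fin.
rewrite big1_seq ?add0e => [|n]; last first.
  rewrite add0n mem_index_iota => /andP[_ /andP[_ nN]].
  rewrite -[tail_norm2 _ _ _]/(pair_norm2 ip (k.2 n - if (n < N)%N then k.2 n else 0)) nN subrr.
  by rewrite -[pair_norm2 ip 0]/(rip ip 0 0 + rip ip 0 0) (rip0l hilbert) addr0.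
rewrite add0n.
rewrite eseries_cond [RHS]eseries_cond; apply: eq_eseriesr => n /= Nn.
rewrite -[tail_norm2 _ (_ - _) _]/(pair_norm2 ip (k.2 n - if (n < N)%N then k.2 n else 0)).
by rewrite ltnNge Nn subr0.
Qed.

End Dilation.

Theorem theorem2p1 (R : realType) (H : lmodType R[i]) (ip : H -> H -> R[i])
  (T1 T2 : {linear H -> H}) :
  is_hilbert_space ip ->
  bounded_op ip T1 -> bounded_op ip T2 ->
  (forall x : H, T1 (T2 x) = T2 (T1 x)) ->
  opnorm ip T1 < 1 -> opnorm ip T2 < 1 ->
  exists V1 V2 : KT H -> KT H,
    [/\ K_isometry ip V1, K_isometry ip V2, K_commute ip V1 V2,
        is_dilation T1 T2 V1 V2 & is_minimal ip V1 V2].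
Proof.
move=> hilbert bT1 bT2 TC T1lt T2lt.
have [q10 T1q] := opnorm_bound hilbert bT1.
have [q20 T2q] := opnorm_bound hilbert bT2.
have [D1 [D2 [U [U' [[D1E D1s] [D2E D2s] [UK UK'] Un UE]]]]] :=
  ando_unitary hilbert q10 T1lt q20 T2lt T1q T2q TC.
exists (dil1 T1 D1 U), (dil2 T2 D2 U'); split.
- exact: dil1_isometry.
- exact: dil2_isometry.
- by move=> k _; exact: dil_comm.
- exact: dil_dilation.
- exact: dil_minimal.
Qed.
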